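(* Assume that $\omega_1\omega\not\longrightarrow(\omega_1\omega,3)^2$, and let $\tau$ be an $\langle\aleph_1,\aleph_1\rangle$-scattered linear order type of size at most $\aleph_1$. Then $\tau\not\longrightarrow(\omega_1^{\omega}\vee(\omega_1^{\omega})^*,3)^2$.
   Context: A linear order $P$ is $\kappa$-dense if $|P|>1$ and for all $a<_P b$ in $P$ the open interval between $a$ and $b$ in $P$ has cardinality at least $\kappa$. For infinite regular $\kappa$, a linear order (type) is $\kappa$-scattered if it has no $\kappa$-dense suborder. A linear order (type) is $\langle\kappa,\mu\rangle$-scattered if an order $P$ of that type is the union $\bigcup_{\zeta<\nu}P_\zeta$ of $\nu$ many $\kappa$-scattered suborders $P_\zeta$ of $P$ for some $\nu<\mu$. The size of an order type is the cardinality of any order of that type; $\varphi^*$ denotes the reverse of $\varphi$. $\omega_1\omega$ is the ordinal product ($\omega$ copies of $\omega_1$ placed one after another) and $\omega_1^\omega$ is ordinal exponentiation. For linear order types $\tau,\varphi_0,\dots,\varphi_k$ and $n<\omega$, $\tau\longrightarrow(\varphi_0\vee\dots\vee\varphi_k,n)^2$ means: whenever $P$ is a linear order of type $\tau$ and $f:[P]^2\to\{0,1\}$ (where $[P]^2$ is the set of two-element subsets of $P$), either there are $i\leq k$ and a suborder $Q\subseteq P$ of type $\varphi_i$ with $f$ constantly $0$ on $[Q]^2$, or there is $Q\subseteq P$ with $n$ elements with $f$ constantly $1$ on $[Q]^2$; $\not\longrightarrow$ is its negation. (With a single $\varphi_0$ this is $\tau\longrightarrow(\varphi_0,n)^2$.)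 *)

(* Defs.v *)
From Stdlib Require List.
From HB Require Import structures.
From mathcomp Require Import all_boot all_order.
From mathcomp Require Import all_classical.

Set Implicit Arguments.
Unset Strict Implicit.
Unset Printing Implicit Defensive.

Import Order.TTheory.
Local Open Scope classical_set_scope.
Local Open Scope card_scope.
Local Open Scope order_scope.

(** Linear order types are handled through representatives: all the notions
    below are invariant under order isomorphism.  Ordinals and cardinals are
    von Neumann style: an ordinal [nu < mu] is an element of the well-order [mu]
    and stands for the initial segment [[set z | z < nu]]; the cardinal aleph_1
    is the initial ordinal [omega1]. *)

Record linType := LinType {
  lin_disp : Order.disp_t;
  lin_order :> orderType lin_disp }.

(** An arbitrary but fixed well-ordering of the power set of [nat]; [omega1] is
    its initial segment made of the elements with countably many
    predecessors. *)
Definition wo_powerset := set nat.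
HB.instance Definition _ := Choice.copy wo_powerset (set nat).

Definition wo_powerset_le : rel wo_powerset :=
  sval (wochoice.well_ordering_principle wo_powerset).

Lemma wo_powerset_leP (A : set wo_powerset) : A !=set0 ->
  exists2 z, A z & forall x, A x -> wo_powerset_le z x.
Proof.
move=> [x Ax]; rewrite /wo_powerset_le; case: wochoice.well_ordering_principle.
move=> R /= /(_ (fun y => y \in A)) [|z [[Az zmin] _]].
  by exists x; rewrite unfold_in; apply/mem_set.
exists z; first by move: Az; rewrite unfold_in => /set_mem.
by move=> y Ay; apply: zmin; rewrite unfold_in; apply/mem_set.
Qed.

Lemma wo_powerset_le_total : total wo_powerset_le.
Proof.
move=> x y; have [|z] := @wo_powerset_leP [set x; y]; first by exists x; left.
by case=> -> zmin; rewrite zmin ?orbT //; [right|left].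
Qed.

Lemma wo_powerset_le_refl : reflexive wo_powerset_le.
Proof. by move=> x; have := wo_powerset_le_total x x; rewrite orbb. Qed.

Lemma wo_powerset_le_anti : antisymmetric wo_powerset_le.
Proof.
rewrite /wo_powerset_le; case: wochoice.well_ordering_principle => R /= Rwo.
apply: (in2T (wochoice.wo_chain_antisymmetric (C := predT) _)).
exact: wochoice.withinW.
Qed.

Lemma wo_powerset_le_trans : transitive wo_powerset_le.
Proof.
move=> y x z xy yz.
have [|t] := @wo_powerset_leP [set x; y; z]; first by exists x; left; left.
move=> [[]|] -> tmin; first by apply: tmin; right.
- have yx : wo_powerset_le y x by apply: tmin; left; left.
  by rewrite (@wo_powerset_le_anti x y) ?xy.
- have zy : wo_powerset_le z y by apply: tmin; left; right.
  by rewrite -(@wo_powerset_le_anti y z) ?yz.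
Qed.

Fact wo_powerset_display : Order.disp_t. Proof. exact: Order.Disp tt tt. Qed.

HB.instance Definition _ := Order.Le_isPOrder.Build wo_powerset_display
  wo_powerset wo_powerset_le_refl wo_powerset_le_anti wo_powerset_le_trans.
HB.instance Definition _ := Order.POrder_isTotal.Build wo_powerset_display
  wo_powerset wo_powerset_le_total.

Definition omega1_pred (x : wo_powerset) : bool := countable [set y | y < x].

Fact omega1_display : Order.disp_t. Proof. exact: Order.Disp tt tt. Qed.

Definition omega1 := {x : wo_powerset | omega1_pred x}.
HB.instance Definition _ := SubChoice.on omega1.
HB.instance Definition _ :=
  [SubChoice_isSubOrder of omega1 by <: with omega1_display].

Lemma omega1_leE (x y : omega1) : (x <= y) = (val x <= val y).
Proof. by []. Qed.

Lemma omega1_ltE (x y : omega1) : (x < y) = (val x < val y).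
Proof. by rewrite !lt_leAnge. Qed.

(** The next three lemmas characterize [omega1] up to isomorphism. *)
Lemma omega1_min (A : set omega1) : A !=set0 ->
  exists2 z, A z & forall x, A x -> z <= x.
Proof.
move=> [a Aa]; have [|z [b Ab bz] zmin] := @wo_powerset_leP (val @` A).
  by exists (val a), a.
exists b => // x Ax; rewrite omega1_leE bz.
by apply: zmin; exists x.
Qed.

Lemma omega1_initial_countable (x : omega1) : countable [set y | y < x].
Proof.
have /countable_injP[f finj] : countable [set y | y < val x] by exact: (valP x).
apply/countable_injP; exists (f \o val) => y z yx zx /finj yz.
by apply/val_inj/yz; rewrite inE /= -omega1_ltE -in_setE.
Qed.

Lemma omega1_uncountable : ~ countable [set: omega1].
Proof.
move=> omC.
have SC : countable [set x | omega1_pred x].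
  move: omC => /countable_injP[f finj]; apply/countable_injP.
  exists (fun x => if insub x is Some y then f y else 0%N) => x y.
  rewrite !inE /= => px py; rewrite !insubT => /finj.
  by move=> /(_ (mem_set I) (mem_set I)) [].
have ST x : omega1_pred x.
  apply: contrapT => nx; have [|z nz zmin] := @wo_powerset_leP (fun x => ~ omega1_pred x).
    by exists x.
  apply: nz; apply: sub_countable SC; apply: subset_card_le => y /= yz.
  by apply: contrapT => /zmin zy; move: yz; rewrite ltNge => /negP.
have /countable_injP[f finj] : countable [set: set nat].
  by apply: sub_countable SC; apply: subset_card_le => y _; exact: ST.
pose D := [set n | exists2 A : set nat, f A = n & ~ A n].
have [DD|nDD] := pselect (D (f D)).
  have [A fA nA] := DD; apply: nA.
  by rewrite (finj A D) ?inE.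
by apply: (nDD); exists D.
Qed.

(** [A * B] is [B] copies of [A] placed one after another. *)
Notation omul A B := (B *l A)%type.

(** [A ^ B] consists of the functions from [B] to [A] which take the value 0 (the
    least element of [A]) at all but finitely many places, compared at the
    largest place where they differ. *)
Section OrdinalExponentiation.
Variables (d : Order.disp_t) (A : orderType d).
Variables (d' : Order.disp_t) (B : orderType d').

Record oexp := OExp {
  oexp_fun :> B -> A;
  oexp_finite_support : finite_set [set b | exists a, a < oexp_fun b] }.

HB.instance Definition _ := gen_eqMixin oexp.
HB.instance Definition _ := gen_choiceMixin oexp.

Definition oexp_lt (f g : oexp) : bool :=
  `[< exists2 b, f b < g b & forall c, b < c -> f c = g c >].

Lemma oexp_lt_irr : irreflexive oexp_lt.
Proof. by move=> f; apply/asboolP => -[b]; rewrite ltxx. Qed.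

Lemma oexp_lt_trans : transitive oexp_lt.
Proof.
move=> g f h /asboolP[b fg fgE] /asboolP[c gh ghE]; apply/asboolP.
have [bc|cb|bc] := ltgtP b c.
- exists c => [|e ce]; first by rewrite fgE.
  by rewrite fgE ?ghE // (lt_trans bc).
- exists b => [|e be]; first by rewrite -ghE.
  by rewrite fgE ?ghE // (lt_trans cb).
- exists b => [|e be]; first by rewrite (lt_trans fg) // bc.
  by rewrite fgE ?ghE // -bc.
Qed.

Fact oexp_display : Order.disp_t. Proof. exact: Order.Disp tt tt. Qed.

HB.instance Definition _ :=
  Order.Lt_isPOrder.Build oexp_display oexp oexp_lt_irr oexp_lt_trans.

Lemma finite_set_has_max (S : set B) : finite_set S -> S !=set0 ->
  exists2 b, S b & forall c, S c -> c <= b.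
Proof.
move=> /finite_seqP[s ->]; elim: s => [[] //|a s IH _].
have [|/set0P/negP/negPn/eqP s0] := pselect ([set` s] !=set0).
  move=> /IH[b /= bs bmax]; have [ab|ba] := leP a b.
    by exists b => [/=|c /=]; rewrite inE ?bs ?orbT // => /orP[/eqP->|/bmax].
  exists a => [/=|c /=]; rewrite inE ?eqxx // => /orP[/eqP->//|/bmax cb].
  exact: le_trans cb (ltW ba).
exists a => [/=|c /=]; rewrite inE ?eqxx // => /orP[/eqP->//|cs].
by have : [set` s] c by []; rewrite s0.
Qed.

Lemma oexp_le_total : total (<=%O : rel oexp).
Proof.
move=> f g; have [->|fg] := eqVneq f g; first by rewrite lexx.
have [||b /eqP fgb bmax] := @finite_set_has_max [set b | f b <> g b].
- apply: sub_finite_set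
    (_ : finite_set ([set b | exists a, a < f b] `|` [set b | exists a, a < g b])).
    move=> b /= /eqP; case: ltgtP => // [fgb|gfb] _.
    + by right; exists (f b).
    + by left; exists (g b).
  by rewrite finite_setU; split; exact: oexp_finite_support.
- apply: contrapT => /forallNP fgE; move/eqP: fg; apply.
  have {}fgE : f = g :> (B -> A).
    by apply/funext => b; apply: contrapT; exact: fgE.
  case: f g fgE => [f fp] [g gp] /= fgE.
  by move: fp gp; rewrite fgE => fp gp; congr OExp; exact: Prop_irrelevance.
have fgE c : b < c -> f c = g c.
  by move=> bc; apply: contrapT => /bmax; rewrite leNgt bc.
move: fgb; case: ltgtP => // fgb _; apply/orP; [left|right];
  apply/ltW/asboolP; exists b => // c bc; by rewrite fgE.
Qed.

HB.instance Definition _ :=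
  Order.POrder_isTotal.Build oexp_display oexp oexp_le_total.

End OrdinalExponentiation.

Section Scattered.
Variables (dk : Order.disp_t) (kappa : orderType dk).
Variables (dm : Order.disp_t) (mu : orderType dm).
Variables (d : Order.disp_t) (T : orderType d).
Implicit Types D P Q : set T.

Definition dense_suborder D :=
  `I_2 #<= D /\
  forall a b, D a -> D b -> a < b ->
    [set: kappa] #<= [set x | D x /\ a < x < b].

Definition scattered P := forall D, D `<=` P -> ~ dense_suborder D.

Definition scattered2 P :=
  exists nu : mu, exists Q : mu -> set T,
    P = \bigcup_(zeta in [set z | z < nu]) Q zeta /\
    forall zeta, zeta < nu -> scattered (Q zeta).

End Scattered.

Definition has_type d (T : orderType d) (Q : set T) (phi : linType) :=
  exists2 h : phi -> T, {mono h : x y / x <= y} & range h = Q.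

Definition pairs T (Q : set T) : set (set T) := [set e | e `<=` Q /\ e #= `I_2].

Definition homogeneous T (f : pairs [set: T] -> bool) (Q : set T) (c : bool) :=
  forall e : pairs [set: T], pairs Q (val e) -> f e = c.

Definition arrow d (tau : orderType d) (phis : seq linType) (n : nat) :=
  forall f : pairs [set: tau] -> bool,
    (exists2 phi, List.In phi phis &
       exists2 Q : set tau, has_type Q phi & homogeneous f Q false) \/
    (exists2 Q : set tau, Q #= `I_n & homogeneous f Q true).

(* Main.v *)
(** Call a subset of a linear order free of order [n] when it contains neither
    [omega1 ^ n] nor its reverse.  For fixed [n] these sets form a
    sigma-ideal, since one piece of a countable partition of [omega1 ^ n]
    contains [omega1 ^ n] again.  As in the Milner-Rado paradox, every
    [omega1]-scattered [P] of size at most aleph_1 is a union of sets [Q n]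
    with [Q n] free of order [n]: the relation "this holds for the interval
    between [x] and [y]" has classes with the same property, and a transversal
    of the classes would be [omega1]-dense if there were two of them.  Hence
    [tau] is such a union, and it injects into [nat * omega1] with [Q n] going
    to the [n]-th column.  Pull back a colouring witnessing the hypothesis.  A
    copy of [omega1 ^ omega] or of its reverse must meet infinitely many
    columns in an uncountable set, so its image contains a copy of
    [omega1 * omega] and cannot be homogeneous of colour 0. *)
Require Import Defs.
From mathcomp Require Import all_boot all_order all_classical.

Set Implicit Arguments.
Unset Strict Implicit.
Unset Printing Implicit Defensive.

Import Order.TTheory.
Local Open Scope order_scope.
Local Open Scope classical_set_scope.
Local Open Scope card_scope.

(** * Uncountable subsets of [omega1] and increasing enumerations *)

Lemma omega1_uncountable_cofinal (U C : set omega1) :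
  ~ countable U -> countable C -> exists2 u, U u & forall c, C c -> c < u.
Proof.
move=> Unc Cc; apply: contrapT => noub; apply: Unc.
apply: (@sub_countable _ _ _ (\bigcup_(c in C) ([set y | y < c] `|` [set c]))).
  apply: subset_card_le => u Uu; apply: contrapT => nu; apply: noub.
  exists u => // c Cc'; rewrite ltNge le_eqVlt; apply/negP => /orP uc.
  by apply: nu; exists c => //; case: uc => [/eqP|] uc; [right|left].
apply: bigcup_countable => //= c _.
rewrite -bigcup2E; apply: bigcup_countable => // i _.
rewrite /bigcup2; case: ifP => _; first exact: omega1_initial_countable.
by case: ifP => _; [exact: countable1|exact: countable0].
Qed.

Lemma omega1_le_countable (a : omega1) : countable [set b | b <= a].
Proof.
have [||u _ ua] := @omega1_uncountable_cofinal [set: omega1] [set a].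
- exact: omega1_uncountable.
- exact: countable1.
apply: sub_countable (omega1_initial_countable u); apply: subset_card_le => b /= ba.
exact: le_lt_trans ba (ua a erefl).
Qed.

(** Well-founded recursion: each value is chosen in [U] above all earlier ones. The second
    hypothesis ranges over every [phi] so that it applies to the function being built. *)
Lemma increasing_enumeration d (W : orderType d) (U : set W) :
  (forall A : set W, A !=set0 -> exists2 z, A z & forall x, A x -> z <= x) ->
  (forall (x : W) (phi : W -> W),
     exists2 u, U u & forall y, y < x -> phi y < u) ->
  exists phi : W -> W, (forall x, U (phi x)) /\ {homo phi : x y / x < y}.
Proof.
move=> Wmin Uunb.
have Wwf : well_founded (fun x y : W => x < y).
  move=> x; apply: contrapT => nx.
  have [z nz zmin] := Wmin (fun x => ~ Acc (fun x y : W => x < y) x) (ex_intro _ x nx).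
  apply: nz; constructor => y yz; apply: contrapT => /zmin.
  by rewrite leNgt yz.
pose good (x : W) (prev : forall y, y < x -> W) u :=
  U u /\ forall y (yx : y < x), prev y yx < u.
pose next (x : W) (prev : forall y, y < x -> W) := xget x (good x prev).
pose phi := Fix Wwf (fun=> W) next.
have phiE x : phi x = next x (fun y _ => phi y).
  rewrite /phi (Fix_eq Wwf) // => y f g fg; congr next.
  by apply: functional_extensionality_dep => z; apply: functional_extensionality_dep => zy; exact: fg.
have phiP x : good x (fun y _ => phi y) (phi x).
  rewrite phiE; apply: xgetPex.
  by have [u Uu ub] := Uunb x phi; exists u; split => // y; exact: ub.
exists phi; split=> [x|x y xy]; first by case: (phiP x).
by case: (phiP y) => _; apply.
Qed.

Lemma omega1_increasing_enumeration (U : set omega1) : ~ countable U ->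
  exists phi : omega1 -> omega1, (forall x, U (phi x)) /\ {homo phi : x y / x < y}.
Proof.
move=> Unc; apply: increasing_enumeration => [|x phi]; first exact: omega1_min.
have [|u Uu ub] := @omega1_uncountable_cofinal U (phi @` [set y | y < x]) Unc.
  exact: sub_countable (card_image_le _ _) (omega1_initial_countable x).
by exists u => // y yx; apply: ub; exists y.
Qed.

Lemma nat_increasing_enumeration (U : set nat) :
  (forall m, exists2 u, U u & (m < u)%N) ->
  exists phi : nat -> nat, (forall x, U (phi x)) /\ {homo phi : x y / (x < y)%N}.
Proof.
move=> Uunb; apply: (@increasing_enumeration _ nat) => [A [a Aa]|x phi].
  have exA : exists n, `[< A n >] by exists a; apply/asboolP.
  case: (ex_minnP exA) => m /asboolP Am mmin; exists m => // y Ay.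
  by apply: mmin; apply/asboolP.
have [u Uu ub] := Uunb (\max_(y < x) phi y)%N.
exists u => // y yx; apply: leq_ltn_trans ub.
exact: (@leq_bigmax _ (fun i : 'I_x => phi i) (Ordinal yx)).
Qed.

Lemma uncountable_bigcup (T I : Type) (U : set T) (J : set I) (F : I -> set T) :
  countable J -> U `<=` \bigcup_(i in J) F i -> ~ countable U ->
  exists2 i, J i & ~ countable (U `&` F i).
Proof.
move=> Jc UF Unc; apply: contrapT => nex; apply: Unc.
apply: (@sub_countable _ _ _ (\bigcup_(i in J) (U `&` F i))).
  by apply: subset_card_le => x Ux; have [i Ji Fx] := UF _ Ux; exists i.
apply: bigcup_countable => // i Ji; apply: contrapT => nc; apply: nex.
by exists i.
Qed.

Lemma in_inj_card_le (T U : Type) (A : set T) (f : T -> U) :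
  {in A &, injective f} -> A #<= f @` A.
Proof. by move=> /inj_card_eq; rewrite card_eq_le => /andP[]. Qed.

(** * Finite powers of [omega1] inside a relation *)

Section Powers.
Variable T : Type.
Implicit Types (R : T -> T -> Prop) (S : set T) (n : nat).

(** Up to passing to an uncountable index set, which is again of type
    [omega1], this says that [S] has a subset of type [omega1 ^ n] in the
    order [R]. *)
Fixpoint has_omega1_power R n S : Prop :=
  if n is n'.+1 then
    exists U : set omega1, exists A : omega1 -> set T,
      [/\ ~ countable U,
          forall a, U a -> A a `<=` S /\ has_omega1_power R n' (A a) &
          forall a b, U a -> U b -> a < b ->
            forall x y, A a x -> A b y -> R x y]
  else S !=set0.

Lemma has_omega1_powerS R n S S' : S `<=` S' ->
  has_omega1_power R n S -> has_omega1_power R n S'.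
Proof.
case: n => [|n] SS' /=; first by case=> x /SS'; exists x.
move=> [U [A [Unc AS Alt]]]; exists U, A; split=> // a Ua.
by have [AaS ?] := AS a Ua; split=> // x /AaS /SS'.
Qed.

Lemma uncountable_pair (U : set omega1) : ~ countable U ->
  exists a b, [/\ U a, U b & a < b].
Proof.
move=> Unc; have [a Ua _] := omega1_uncountable_cofinal Unc (@countable0 _).
have [b Ub ab] := omega1_uncountable_cofinal Unc (@countable1 _ a).
by exists a, b; split=> //; apply: ab.
Qed.

Lemma has_omega1_power_pred R n S :
  has_omega1_power R n.+1 S -> has_omega1_power R n S.
Proof.
move=> [U [A [/uncountable_pair[a [_ [Ua _ _]]] AS _]]].
by have [AaS] := AS a Ua; exact: has_omega1_powerS.
Qed.

Lemma has_omega1_power_leq R m n S : (m <= n)%N ->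
  has_omega1_power R n S -> has_omega1_power R m S.
Proof.
move=> /subnK <-; elim: (n - m)%N => // k IH.
by rewrite addSn => /has_omega1_power_pred.
Qed.

Lemma has_omega1_power_nonempty R n S : has_omega1_power R n S -> S !=set0.
Proof. exact: (@has_omega1_power_leq R 0 n S (leq0n n)). Qed.

(** Induction on [n]: each block has a piece capturing the smaller power, and uncountably many
    blocks share the same piece. *)
Lemma has_omega1_power_bigcup R n (I : Type) (J : set I) (F : I -> set T) S :
  countable J -> S `<=` \bigcup_(i in J) F i -> has_omega1_power R n S ->
  exists2 i, J i & has_omega1_power R n (S `&` F i).
Proof.
move=> Jc; elim: n S => [|n IH] S SF /=.
  by case=> x Sx; have [i Ji Fx] := SF _ Sx; exists i => //; exists x.
move=> [U [A [Unc AS Alt]]].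
have [|i Ji Uinc] := @uncountable_bigcup _ _ U J
    (fun i => [set a | has_omega1_power R n (A a `&` F i)]) Jc _ Unc.
  move=> a Ua; have [AaS Aan] := AS a Ua.
  by have [i Ji ?] := IH (A a) (subset_trans AaS SF) Aan; exists i.
exists i => //; exists (U `&` [set a | has_omega1_power R n (A a `&` F i)]).
exists (fun a => A a `&` F i); split=> // [a [Ua Aan]|a b [Ua _] [Ub _] ab x y].
  by split=> // x [Aax Fx]; split=> //; have [AaS _] := AS a Ua; exact: AaS.
by move=> [Ax _] [By _]; apply: Alt Ax By.
Qed.

(** If [S] were countable, one of its singletons would contain a positive power; two blocks would
    then share that point, against irreflexivity. *)
Lemma has_omega1_power_uncountable R n S : (forall x, ~ R x x) ->
  has_omega1_power R n.+1 S -> ~ countable S.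
Proof.
move=> Rirr Sn Sc.
have [|x _ [U [A [/uncountable_pair[a [b [Ua Ub ab]]] AS Alt]]]] :=
  @has_omega1_power_bigcup R n.+1 T S (fun x => [set x]) S Sc _ Sn.
  by move=> x Sx; exists x.
have [Aax /has_omega1_power_nonempty[y Aay]] := AS a Ua.
have [Abx /has_omega1_power_nonempty[z Abz]] := AS b Ub.
have [_ /= yx] := Aax _ Aay; have [_ /= zx] := Abx _ Abz.
by apply: (Rirr x); rewrite -{1}yx -zx; apply: Alt Aay Abz.
Qed.

Definition power_free R n S :=
  ~ has_omega1_power R n S /\ ~ has_omega1_power (fun x y => R y x) n S.

Lemma power_free_bigcup R n (I : Type) (J : set I) (F : I -> set T) :
  countable J -> (forall i, J i -> power_free R n (F i)) ->
  power_free R n (\bigcup_(i in J) F i).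
Proof.
move=> Jc FR; split=> /(has_omega1_power_bigcup Jc (@subset_refl _ _))[i Ji];
  by move=> /(has_omega1_powerS (@subIsetr _ _ _)); case: (FR i Ji).
Qed.

(** * Milner-Rado decompositions *)

Definition milner_rado R S :=
  exists2 Q : nat -> set T, S `<=` \bigcup_n Q n & forall n, power_free R n (Q n).

Lemma milner_rado_flip R S : milner_rado R S -> milner_rado (fun x y => R y x) S.
Proof. by move=> [Q SQ QR]; exists Q => // n; have [] := QR n; split. Qed.

Lemma milner_radoS R S S' : S `<=` S' -> milner_rado R S' -> milner_rado R S.
Proof. by move=> SS' [Q SQ QR]; exists Q => //; exact: subset_trans SQ. Qed.

Lemma milner_rado0 R : milner_rado R set0.
Proof.
exists (fun=> set0) => // n.
by split=> /has_omega1_power_nonempty[].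
Qed.

(** The [n]-th pieces of all the [F i] merge into one set, still free of order [n] because the union
    is countable. *)
Lemma milner_rado_bigcup R (I : Type) (J : set I) (F : I -> set T) :
  countable J -> (forall i, J i -> milner_rado R (F i)) ->
  milner_rado R (\bigcup_(i in J) F i).
Proof.
move=> Jc FR.
have [Q QP] : {Q : I -> nat -> set T & forall i, J i ->
    F i `<=` \bigcup_n Q i n /\ forall n, power_free R n (Q i n)}.
  apply: (@choice _ _ (fun i Qi => J i -> F i `<=` \bigcup_n Qi n /\
     forall n, power_free R n (Qi n))) => i.
  have [Ji|nJi] := pselect (J i); last by exists (fun=> set0).
  by have [Q FQ QR] := FR i Ji; exists Q.
exists (fun n => \bigcup_(i in J) Q i n) => [x [i Ji Fx]|n].
  by have [/(_ _ Fx)[n _ Qx] _] := QP i Ji; exists n => //; exists i.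
by apply: power_free_bigcup => // i Ji; case: (QP i Ji).
Qed.

Lemma milner_rado_setU R S S' :
  milner_rado R S -> milner_rado R S' -> milner_rado R (S `|` S').
Proof.
move=> SR SR'; rewrite -bigcup2E; apply: milner_rado_bigcup => // i _.
rewrite /bigcup2; case: ifP => // _; case: ifP => // _; exact: milner_rado0.
Qed.

(** Below the image of any point only countably many fibres are involved,
    so one of them captures a bounded copy of [omega1 ^ n]; a copy of
    [omega1 ^ n.+1], or of its reverse, contains such a bounded copy. *)
Lemma milner_rado_fibers R S (g : T -> omega1) :
  (forall x y, S x -> S y -> R x y -> g x <= g y) ->
  (forall a, milner_rado R (S `&` [set x | g x = a])) ->
  milner_rado R S.
Proof.
move=> gmono fibR.
have [Q QP] : {Q : omega1 -> nat -> set T & forall a,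
    S `&` [set x | g x = a] `<=` \bigcup_n Q a n /\
    forall n, power_free R n (Q a n)}.
  apply: (@choice _ _ (fun a Qa => S `&` [set x | g x = a] `<=` \bigcup_n Qa n /\
    forall n, power_free R n (Qa n))) => a.
  by have [Q SQ QR] := fibR a; exists Q.
(* Only the empty set is free of order 0. The shift by one leaves room to trade a copy of order
   [n.+1] for a bounded block of order [n]. *)
exists (fun n => if n is n'.+1 then S `&` [set x | Q (g x) n' x] else set0).
  move=> x Sx; have [/(_ x (conj Sx erefl))[n _ Qx] _] := QP (g x).
  by exists n.+1.
move=> [|n]; first by split=> /has_omega1_power_nonempty[].
set Y := S `&` _.
have bounded R' A z : A `<=` Y -> has_omega1_power R' n A ->
    (forall x, A x -> g x <= g z) ->
    exists a, has_omega1_power R' n (Q a n).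
  move=> AY An Az.
  have [|a _ Aa] := has_omega1_power_bigcup (omega1_le_countable (g z))
     (F := fun a => [set x | g x = a]) _ An.
    by move=> x Ax; exists (g x) => //; exact: Az.
  exists a; apply: has_omega1_powerS Aa => x [/AY[_ /= Qx] /= gx].
  by rewrite -gx.
split=> -[U [A [/uncountable_pair[a [b [Ua Ub ab]]] AY Alt]]].
- have [AaY Aan] := AY a Ua; have [AbY /has_omega1_power_nonempty[z Abz]] := AY b Ub.
  have [|c Qc] := bounded R _ z AaY Aan.
    move=> x Aax; apply: gmono; first by case: (AaY _ Aax).
      by case: (AbY _ Abz).
    exact: Alt Aax Abz.
  by have [_ /(_ n)[]] := QP c.
(* For the reverse relation later blocks lie lower, so block [b] is bounded by a point of block
   [a]. *)
- have [AbY Abn] := AY b Ub; have [AaY /has_omega1_power_nonempty[z Aaz]] := AY a Ua.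
  have [|c Qc] := bounded (fun x y => R y x) _ z AbY Abn.
    move=> x Abx; apply: gmono; first by case: (AbY _ Abx).
      by case: (AaY _ Aaz).
    exact: Alt Aaz Abx.
  by have [_ /(_ n)[]] := QP c.
Qed.

(** Let [g x] be the least [e]-index of a point of [S] equal to or above [x]. It is monotone and
    each fibre lies at or below one point; this replaces a cofinal sequence. *)
Lemma milner_rado_cofinal R S (e : T -> omega1) : injective e ->
  (forall x y z, R x y -> R y z -> R x z) ->
  (forall y, S y -> milner_rado R (S `&` [set x | x = y \/ R x y])) ->
  milner_rado R S.
Proof.
move=> einj Rtrans Sini.
pose above x a := exists2 y, S y & e y = a /\ (x = y \/ R x y).
have [g gP] : {g : T -> omega1 & forall x, S x ->
    above x (g x) /\ forall a, above x a -> g x <= a}.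
  apply: (@choice _ _ (fun x a => S x -> above x a /\ forall b, above x b -> a <= b)).
  move=> x; have [Sx|nSx] := pselect (S x); last by exists (e x).
  have [|a] := @omega1_min (above x); last by exists a.
  by exists (e x), x => //; split=> //; left.
apply: (@milner_rado_fibers R S g) => [x y Sx Sy Rxy|a].
  have [_ gmin] := gP x Sx; have [[z Sz [ez yz]] _] := gP y Sy.
  apply: gmin; exists z => //; split=> //; right.
  by case: yz => [<-//|]; exact: Rtrans.
have [[y [Sy ey]]|ny] := pselect (exists y, S y /\ e y = a).
  apply: milner_radoS (Sini y Sy) => x [Sx /= gx]; split=> //.
  have [[z Sz [ez xz]] _] := gP x Sx; by have -> : y = z by apply: einj; rewrite ez gx.
apply: milner_radoS (milner_rado0 R) => x [Sx /= gx]; apply: ny.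
by have [[z Sz [ez _]] _] := gP x Sx; exists z; rewrite ez gx.
Qed.

End Powers.

(** * Decomposition of [omega1]-scattered sets *)

Section ScatteredMilnerRado.
Variables (d : Order.disp_t) (T : orderType d) (e : T -> omega1).
Hypothesis einj : injective e.
Implicit Types P : set T.

Let ltT (x y : T) : Prop := x < y.

Lemma uncountable_card_ge_omega1 P : ~ countable P -> [set: omega1] #<= P.
Proof.
move=> Pnc; have [|phi [phiP phi_lt]] := @omega1_increasing_enumeration (e @` P).
  move=> ePc; apply: Pnc; apply: sub_countable ePc.
  by apply: in_inj_card_le; exact: in2W.
have phi_inj : injective phi by apply: inc_inj; exact: le_mono.
apply: (@card_le_trans _ _ _ (phi @` [set: omega1])).
  by apply: in_inj_card_le; exact: in2W.
apply: card_le_trans (card_image_le e P).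
by apply: subset_card_le => _ [x _ <-].
Qed.

(** Identify two points of [P] when the part of [P] between them is a countable
    union of sets free of finite powers of [omega1].  The classes are convex
    and inherit this property; a transversal [D] is then [omega1]-dense, because
    an interval of [D] that is countable would make its endpoints equivalent. *)
Lemma scattered_milner_rado P : scattered omega1 P -> milner_rado ltT P.
Proof.
move=> Pscat.
pose itv (x y : T) := P `&` [set z | x <= z <= y].
pose sim x y := milner_rado ltT (itv x y `|` itv y x).
have simC x y : sim x y -> sim y x by rewrite /sim setUC.
have simW x y x' y' : x <= x' -> y' <= y -> sim x y -> milner_rado ltT (itv x' y').
  move=> xx' yy'; apply: milner_radoS => z [Pz /andP[xz zy]]; left; split=> //=.
  by rewrite (le_trans xx' xz) (le_trans zy yy').
have sim_le x y : x <= y -> milner_rado ltT (itv x y) -> sim x y.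
  move=> xy xyM; apply: milner_radoS xyM => z [//|[Pz /andP[yz zx]]].
  by split=> //=; rewrite (le_trans xy yz) (le_trans zx xy).
have sim_trans x y z : sim x y -> sim y z -> sim x z.
  move=> xy yz; apply: milner_radoS (milner_rado_setU xy yz) => t.
  move=> [[Pt /andP[xt tz]]|[Pt /andP[zt tx]]].
    have [ty|/ltW yt] := leP t y; [left; left|right; left]; split=> //=;
    exact/andP.
  have [ty|/ltW yt] := leP t y; [right; right|left; right]; split=> //=;
  exact/andP.
pose cls x := P `&` [set y | sim x y].
have cls_sim x y : sim x y -> cls x = cls y.
  move=> xy; apply/seteqP; split=> z [Pz /= h]; split=> //=.
    exact: sim_trans (simC _ _ xy) h.
  exact: sim_trans xy h.
have clsM c : milner_rado ltT (cls c).
  (* The points of the class between [c] and a member [y] lie in an interval with similar endpoints,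
     so the cofinality lemma applies; the lower half is the same in the reverse order. *)
  have up : milner_rado ltT (cls c `&` [set x | c <= x]).
    apply: (milner_rado_cofinal einj) => [x y z|y [[Py cy] /= _]].
      exact: lt_trans.
    apply: (milner_radoS _ (simW c y c y _ _ cy)) => //.
    move=> x [[[Px _] /= cx] xy]; split=> //=; rewrite cx.
    by case: xy => [->|xy]; rewrite ?lexx ?(ltW xy).
  have down : milner_rado ltT (cls c `&` [set x | x <= c]).
    apply: (@milner_rado_flip _ (fun x y => y < x)).
    apply: (milner_rado_cofinal einj) => [x y z xy yz|y [[Py cy] /= _]].
      exact: lt_trans yz xy.
    apply: milner_rado_flip; apply: (milner_radoS _ (simW y c y c _ _ (simC _ _ cy))) => //.
    move=> x [[[Px _] /= xc] xy]; split=> //=; rewrite xc andbT.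
    by case: xy => [->|xy]; rewrite ?lexx ?(ltW xy).
  apply: milner_radoS (milner_rado_setU up down) => x cx.
  by have [|/ltW] := leP c x; [left|right].
pose rep x := xget x (cls x).
have simxx x : P x -> sim x x.
  move=> Px; apply: sim_le => //.
  exists (fun n => if n is n'.+1 then [set x] else set0).
    by move=> y [Py /andP[xy yx]]; exists 1%N => //=; apply/eqP; rewrite eq_le yx.
  case=> [|n]; first by split=> /has_omega1_power_nonempty[].
  by split=> /has_omega1_power_uncountable h; apply: h (countable1 x);
    move=> z; rewrite /ltT ltxx.
have repP x : P x -> cls x (rep x).
  by move=> Px; apply: xgetPex; exists x; split=> //; exact: simxx.
have rep_sim x y : P x -> P y -> sim x y -> rep x = rep y.
  move=> Px Py xy; rewrite /rep (cls_sim _ _ xy).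
  have := repP y Py; rewrite /rep.
  set C := cls y => _; have Cy : C y by split=> //; exact: simxx.
  (* Both sides choose from the same nonempty class, so the different defaults [x] and [y] are never
     returned. *)
  by rewrite /xget; case: pselect => // nC; case: nC; exists y; apply/asboolP.
pose D := rep @` P.
have D_sim x y : D x -> D y -> sim x y -> x = y.
  move=> [x' Px' <-] [y' Py' <-] xy; apply: rep_sim => //.
  have [_ xx'] := repP _ Px'; have [_ yy'] := repP _ Py'.
  exact: sim_trans xx' (sim_trans _ _ _ xy (simC _ _ yy')).
have DP x : D x -> P x by move=> [y Py <-]; case: (repP y Py).
have [[a [b [Da Db ab]]]|D1] := pselect (exists a b, [/\ D a, D b & a < b]).
  exfalso; apply: (Pscat D DP); split.
    pose f n := if n is 0 then a else b.
    apply: (@card_le_trans _ _ _ (f @` `I_2)).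
      apply: in_inj_card_le => [[|[|i]] [|[|j]]] //; rewrite !inE //= => _ _ E;
      by move: ab; rewrite E ltxx.
    by apply: subset_card_le => _ [[|[|i]] // _ <-].
  move=> {Da Db ab}a {}b Da Db ab; apply: uncountable_card_ge_omega1 => Dabc.
  (* If the representative of [x] lies outside the open interval, then [a] or [b] lies between it
     and [x], so [x] belongs to the class of that endpoint. *)
  have cov : itv a b `<=` \bigcup_(x in [set x | D x /\ a < x < b]) cls x `|`
       (cls a `|` cls b).
    move=> x [Px /andP[ax xb]]; have [Pr xr] := repP x Px.
    have Dr : D (rep x) by exists x.
    have [ra|ar] := leP (rep x) a.
      right; left; split=> //=; apply: (sim_le _ _ ax).
      exact: simW (simC _ _ xr).
    have [br|rb] := leP b (rep x).
      right; right; split=> //=; apply: simC; apply: (sim_le _ _ xb).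
      exact: simW xr.
    left; exists (rep x) => /=; first by rewrite ar.
    by split=> //; exact: simC.
  have/eqP := lt_eqF ab; apply; apply: D_sim => //; apply: sim_le (ltW ab) _.
  apply: milner_radoS cov _; apply: milner_rado_setU; last exact: milner_rado_setU.
  by apply: milner_rado_bigcup.
have [[c Pc]|P0] := pselect (P !=set0).
  apply: milner_radoS (clsM (rep c)) => x Px; split=> //=.
  have -> : rep c = rep x.
    have [||//] := ltgtP (rep c) (rep x) => h; exfalso; apply: D1.
      by exists (rep c), (rep x); split=> //; [exists c|exists x].
    by exists (rep x), (rep c); split=> //; [exists x|exists c].
  by have [_] := repP x Px; exact: simC.
by apply: milner_radoS (milner_rado0 _) => x Px; apply: P0; exists x.
Qed.

End ScatteredMilnerRado.

(** * Copies of powers of [omega1] and of [omega1 * omega] *)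

Lemma has_omega1_power_image (T T' : Type) (R : T -> T -> Prop)
    (R' : T' -> T' -> Prop) (h : T -> T') n (S : set T) :
  (forall x y, R x y -> R' (h x) (h y)) ->
  has_omega1_power R n S -> has_omega1_power R' n (h @` S).
Proof.
move=> hR; elim: n S => [|n IH] S; first by case=> x Sx; exists (h x), x.
move=> [U [A [Unc AS Alt]]]; exists U, (fun a => h @` A a); split=> // [a Ua|].
  have [AaS Aan] := AS a Ua; split; last exact: IH.
  by move=> _ [x Ax <-]; exists x => //; exact: AaS.
move=> a b Ua Ub ab _ _ [x Ax <-] [y By <-]; apply: hR.
exact: Alt Ua Ub ab _ _ Ax By.
Qed.

(** The functions agreeing with [f] from place [n] on form a copy of
    [omega1 ^ n]; those with a fixed value at place [n] form the [omega1]
    consecutive blocks of the copy of [omega1 ^ n.+1]. *)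
Lemma oexp_has_omega1_power n (f : oexp omega1 nat) :
  has_omega1_power (fun g h : oexp omega1 nat => g < h) n
    [set g : oexp omega1 nat | forall c, (n <= c)%N -> g c = f c].
Proof.
elim: n f => [|n IH] f; first by exists f.
have upd_fin (a : omega1) :
    finite_set [set b | exists z, z < (if b == n then a else f b)].
  apply: (@sub_finite_set _ _ ([set b | exists z, z < f b] `|` [set n])).
    by move=> b /= [z]; case: eqP => [->|_ zb]; [right|left; exists z].
  by rewrite finite_setU; split; [exact: oexp_finite_support|exact: finite_set1].
exists [set: omega1], (fun a => [set g : oexp omega1 nat | forall c, (n <= c)%N ->
  g c = OExp (upd_fin a) c]); split.
- exact: omega1_uncountable.
- move=> a _; split; last exact: IH.
  by move=> g /= gE c nc; rewrite gE ?(ltnW nc) //= gtn_eqF.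
- move=> a b _ _ ab g h gE hE; apply/asboolP; exists n.
    by rewrite gE ?hE //= eqxx.
  by move=> c nc; rewrite gE ?hE ?(ltnW nc) //= gtn_eqF.
Qed.

(** The constant least element has empty support; it serves as base point for
    [oexp_has_omega1_power]. *)
Lemma oexp_omega1_inhabited : oexp omega1 nat.
Proof.
have [|z _ zmin] := cid2 (@omega1_min [set: omega1] _).
  have [u _ _] := omega1_uncountable_cofinal omega1_uncountable (@countable0 _).
  by exists u.
apply: (@OExp _ _ _ _ (fun=> z)); apply: sub_finite_set (@finite_set0 nat).
by move=> b [a]; rewrite ltNge zmin.
Qed.

(** List uncountable columns increasingly and take an increasing copy of [omega1] in each; the
    lexicographic order glues them. *)
Lemma omega1_omega_subset (Q : set (omul omega1 nat)) :
  (forall m, exists2 i, ~ countable [set a | Q (i, a)] & (m < i)%N) ->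
  exists2 Q', Q' `<=` Q & has_type Q' (LinType (omul omega1 nat)).
Proof.
move=> Qcol; have [iota [iotaP iota_lt]] := nat_increasing_enumeration Qcol.
have [psi psiP] : {psi : nat -> omega1 -> omega1 & forall i,
    (forall a, Q (iota i, psi i a)) /\ {homo psi i : a b / a < b}}.
  apply: (@choice _ _ (fun i p => (forall a, Q (iota i, p a)) /\
    {homo p : a b / a < b})) => i.
  exact: omega1_increasing_enumeration (iotaP i).
pose h (x : omul omega1 nat) : omul omega1 nat := (iota x.1, psi x.1 x.2).
exists (range h).
  by move=> _ [[i a] _ <-]; exact: (proj1 (psiP i)).
suff h_lt : {homo h : x y / x < y} by exists h => //; exact: le_mono.
move=> [i a] [j b]; rewrite !ltEprodlexi /= => /andP[].
rewrite le_eqVlt => /orP[/eqP<-|ij].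
  by rewrite !lexx /= => /(proj2 (psiP i)).
have ij' : iota i < iota j by exact: iota_lt.
by move=> _; rewrite (ltW ij') /= leNgt ij'.
Qed.

(** * Transport of colourings along an injection *)

Lemma pairs_image (T T' : Type) (k : T -> T') (e : set T) : injective k ->
  pairs [set: T] e -> pairs [set: T'] (k @` e).
Proof.
move=> kinj [_ e2]; split=> //; apply: card_eq_trans e2.
by apply: inj_card_eq; exact: in2W.
Qed.

(** A pair inside the image of [Q] comes from its preimage in [Q], again a pair by injectivity. *)
Lemma homogeneous_image (T T' : Type) (k : T -> T') (kinj : injective k)
    (f : pairs [set: T'] -> bool) (Q : set T) c :
  homogeneous (fun e => f (SigSub (mem_set (pairs_image kinj (set_valP e))))) Q c ->
  homogeneous f (k @` Q) c.
Proof.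
move=> hQ e [eQ e2].
pose e' := Q `&` k @^-1` val e.
have ke' : k @` e' = val e.
  apply/seteqP; split=> [_ [x [_ ?] <-] //|y ey].
  by have [x Qx xy] := eQ y ey; exists x => //; split=> //=; rewrite xy.
have e'2 : pairs [set: T] e'.
  split=> //; apply: card_eq_trans e2; rewrite -ke' card_eq_sym.
  by apply: inj_card_eq; exact: in2W.
have := hQ (SigSub (mem_set e'2)) (conj (@subIsetl _ _ _) (proj2 e'2)).
by congr (f _ = _); apply: val_inj.
Qed.

Theorem theorem5p9
  (Homega1omega :
     ~ arrow (omul omega1 nat) [:: LinType (omul omega1 nat)] 3)
  (d : Order.disp_t) (tau : orderType d)
  (tau_scattered : scattered2 omega1 omega1 [set: tau])
  (tau_size : [set: tau] #<= [set: omega1]) :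
  ~ arrow tau [:: LinType (oexp omega1 nat); LinType (oexp omega1 nat)^d] 3.
Proof.
have [e einj] : exists e : tau -> omega1, injective e.
  have /card_leP[g] := tau_size.
  exists (fun x => val (g (SigSub (mem_set (I : [set: tau] x))))) => x y /val_inj gxy.
  exact: (congr1 val (@inj _ _ _ g _ _ (mem_set I) (mem_set I) gxy)).
have [Q Qcover Qfree] : milner_rado (fun x y : tau => x < y) [set: tau].
  have [nu [P [-> Pscat]]] := tau_scattered.
  apply: milner_rado_bigcup; first exact: omega1_initial_countable.
  by move=> zeta zetanu; apply: (scattered_milner_rado einj); exact: Pscat.
have [col colP] : {col : tau -> nat & forall x, Q (col x) x}.
  apply: (@choice _ _ (fun x n => Q n x)) => x; have [n _ Qx] := Qcover x I.
  by exists n.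
pose k x : omul omega1 nat := (col x, e x).
have kinj : injective k by move=> x y [_ /einj].
have no_power (H : set tau) R : (R = (fun x y : tau => x < y)) \/
    (R = (fun x y : tau => y < x)) -> (forall n, has_omega1_power R n H) ->
    exists2 Q', Q' `<=` k @` H & has_type Q' (LinType (omul omega1 nat)).
  move=> RE Hbig; apply: omega1_omega_subset => m.
  (* Some column captures order [m.+1]. As this is positive, the column is uncountable; and [i <= m]
     is impossible, since column [i] lies in [Q i], free of order [i]. *)
  have [||i _ Hi] := @has_omega1_power_bigcup _ R m.+1 nat setT
      (fun i => [set x | col x = i]) H _ _ (Hbig m.+1).
  - exact: countableP.
  - by move=> x _; exists (col x).
  exists i.
    have Rirr x : ~ R x x by case: RE => ->; rewrite ltxx.
    have Hinc := has_omega1_power_uncountable Rirr Hi.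
    move=> colc; apply: Hinc; apply: sub_countable colc.
    apply: card_le_trans (in_inj_card_le (in2W einj)) _.
    by apply: subset_card_le => _ [x [Hx <-] <-]; exists x.
  rewrite ltnNge; apply/negP => im.
  have {}Hi : has_omega1_power R i (Q i).
    apply: (has_omega1_powerS _ (has_omega1_power_leq (leqW im) Hi)).
    by move=> x [_ /= <-].
  by case: RE Hi => ->; case: (Qfree i).
have /existsNP[f0 /not_orP[f0no0 f0no1]] := Homega1omega.
(* Each pair of [tau] gets the colour that [f0] gives to its image under [k]. *)
move=> /(_ (fun e => f0 (SigSub (mem_set (pairs_image kinj (set_valP e)))))).
case=> [[phi phiE [H [h hmono hH] H0]]|[H H3 H1]]; last first.
  apply: f0no1; exists (k @` H); last exact: homogeneous_image H1.
  by apply: card_eq_trans H3; apply: inj_card_eq; exact: in2W.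
have [Q' Q'H Q'type] : exists2 Q', Q' `<=` k @` H &
    has_type Q' (LinType (omul omega1 nat)).
  have f1 : oexp omega1 nat by exact: oexp_omega1_inhabited.
  rewrite -hH; case: phiE h hmono {hH} => [<-|[<-|[]]] h hmono.
    apply: (no_power _ (fun x y => x < y)); first by left.
    move=> n; apply: has_omega1_power_image; last first.
      exact: has_omega1_powerS (@subsetT _ _) (oexp_has_omega1_power n f1).
    by move=> x y xy; rewrite (leW_mono hmono).
  apply: (no_power _ (fun x y => y < x)); first by right.
  move=> n; apply: has_omega1_power_image; last first.
    exact: has_omega1_powerS (@subsetT _ _) (oexp_has_omega1_power n f1).
  by move=> x y xy; rewrite (leW_mono hmono).
apply: f0no0; exists (LinType (omul omega1 nat)); first by left.
exists Q' => // e' [e'Q' e'2]; apply: (homogeneous_image H0).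
by split=> //; exact: subset_trans Q'H.
Qed.
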